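(* In the real (resp. complex) projective 3-space, let $f,f_{12},f_{13},f_{23}$ be four lines and let $f_1,f_2,f_3$ be three points. Assume that the lines $f_{12},f_{13},f_{23}$ lie in one plane, that the three tiles with vertices labeled in cyclic order by $$(f,f_1,f_{12},f_2),\quad (f,f_1,f_{13},f_3),\quad (f,f_2,f_{23},f_3)$$ are coherent, and that the seven inputs $f,f_i,f_{ij}$ are generic subject to the conditions that the lines $f_{12},f_{13},f_{23}$ lie in one plane and that these three tiles are coherent. Then there exists a unique point $f_{123}$ such that the three tiles $$(f_1,f_{12},f_{123},f_{13}),\quad (f_2,f_{12},f_{123},f_{23}),\quad (f_3,f_{13},f_{123},f_{23})$$ are coherent.
   Context: Coherence of a tile in 3-space labeled by points and lines: for distinct points $A,B$ and distinct lines $\ell,m$ in projective 3-space, the tile with vertices labeled cyclically $A,\ell,B,m$ is coherent if neither $A$ nor $B$ is incident to either $\ell$ or $m$, the lines $\ell$ and $m$ intersect at some point $P$, and the line $(AB)$ passes through $P$. The notion does not depend on which of the four vertices is listed first or on the direction of listing. ''Generic'' means belonging to a suitable Zariski dense (concretely, nonempty Zariski open) subset of the space of configurations satisfying the stated conditions. *)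

(* Defs.v *)
From HB Require Import structures.
From mathcomp Require Import all_boot all_order all_algebra.
From mathcomp Require Import reals complex.
From mathcomp Require Import mpoly.

Set Implicit Arguments.
Unset Strict Implicit.
Unset Printing Implicit Defensive.

Import GRing.Theory.
Local Open Scope ring_scope.

Section Incidence.

Variable F : fieldType.

(* A k-dimensional flat of P^3(F) is a (k+1)-dimensional subspace of F^4.
   Incidence is inclusion of subspaces, and the line through two distinct
   points A and B is the subspace A + B. *)
Record flat (k : nat) := Flat {
  flat_space :> {vspace 'rV[F]_4};
  flat_dim : \dim flat_space == k.+1
}.

Definition point := flat 0.
Definition line := flat 1.
Definition plane := flat 2.

(* The labels A, l, B, m are listed in cyclic order around the tile. *)
Definition coherent (A : point) (l : line) (B : point) (m : line) : Prop :=
  [/\ A <> B, l <> m,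
      [/\ ~~ (A <= l)%VS, ~~ (A <= m)%VS, ~~ (B <= l)%VS & ~~ (B <= m)%VS] &
      exists P : point, [/\ (P <= l)%VS, (P <= m)%VS & (P <= A + B)%VS]].

Definition coplanar (l m n : line) : Prop :=
  exists S : plane, [/\ (l <= S)%VS, (m <= S)%VS & (n <= S)%VS].

Record config := Config {
  f0 : line;
  f1 : point;
  f2 : point;
  f3 : point;
  f12 : line;
  f13 : line;
  f23 : line
}.

(* The tile (f, f_i, f_ij, f_j) is listed from f_i, since [coherent] expects a
   point first. *)
Definition admissible (c : config) : Prop :=
  [/\ coplanar (f12 c) (f13 c) (f23 c),
      coherent (f1 c) (f12 c) (f2 c) (f0 c),
      coherent (f1 c) (f13 c) (f3 c) (f0 c) &
      coherent (f2 c) (f23 c) (f3 c) (f0 c)].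

Definition completes (c : config) (f123 : point) : Prop :=
  [/\ coherent (f1 c) (f12 c) f123 (f13 c),
      coherent (f2 c) (f12 c) f123 (f23 c) &
      coherent (f3 c) (f13 c) f123 (f23 c)].

End Incidence.

Section Zariski.

Variable F : fieldType.

(* The k+1 rows of X span U; they are then a basis of U, by dimension. *)
Definition frame (k : nat) (X : 'M[F]_(k.+1, 4)) (U : flat F k) : Prop :=
  (U : {vspace _}) = (\sum_(i < k.+1) <[row i X]>)%VS.

(* A choice of frames for the seven members of a configuration, stacked into
   one matrix: two rows for each line and one row for each point. *)
Definition frames (X : 'M[F]_(2 + (1 + (1 + (1 + (2 + (2 + 2))))), 4))
    (c : config F) : Prop :=
  exists (L L12 L13 L23 : 'M[F]_(2, 4)) (a1 a2 a3 : 'M[F]_(1, 4)),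
    X = col_mx L (col_mx a1 (col_mx a2 (col_mx a3
          (col_mx L12 (col_mx L13 L23))))) /\
    [/\ frame L (f0 c),
        [/\ frame a1 (f1 c), frame a2 (f2 c) & frame a3 (f3 c)] &
        [/\ frame L12 (f12 c), frame L13 (f13 c) & frame L23 (f23 c)]].

(* U is a Zariski open subset of C, both being sets of configurations.  The
   Zariski topology on a product of copies of P^3 and of the Grassmannian of
   lines is the quotient of that of the space of frames (which has local
   polynomial sections over the standard charts).  So U is open in C when
   "c is in U" is equivalent, for c in C and for every choice of frames of c,
   to the non-vanishing at the matrix entries of some polynomial of a fixed
   family S. *)
Definition zariski_open_in (C U : config F -> Prop) : Prop :=
  (forall c, U c -> C c) /\
  exists S : {mpoly F[44]} -> Prop,
    forall c X, C c -> frames X c ->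
      (U c <-> exists2 p, S p & p.@[fun k => mxvec X 0 k] != 0).

(* "Generic" is membership in some nonempty Zariski open subset U of C.  This
   does not ask U to be dense in C, which would be too strong here: the
   admissible configurations with f_1, f_2, f_3 collinear form a second
   irreducible component of the same dimension, on which f_123 is never
   unique. *)
Definition generically_in (C Q : config F -> Prop) : Prop :=
  exists U : config F -> Prop,
    [/\ zariski_open_in C U, exists c, U c & forall c, U c -> Q c].

End Zariski.

(* Main.v *)
Require Import Defs.
From HB Require Import structures.
From mathcomp Require Import all_boot all_order all_algebra.
From mathcomp Require Import reals complex.
From mathcomp Require Import mpoly ring.

(** The tiles encode Desargues' theorem for the triangle [f1 f2 f3] and the
triangle cut out by the three coplanar lines [f12], [f13], [f23]: the
coherence of the three given tiles says that corresponding sides meet on the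
line [f], and the coherence of the three wanted tiles says that the lines
joining corresponding vertices pass through [f123].  The argument works over
every field.

The open condition is [triangular]: the lines [f12], [f13], [f23] have no
common point, and [f1] is outside the plane V = [f12] + [f13] + [f23].

Under this condition the points have canonical vectors.  A vector u1 of [f1]
is not in V.  A coherent tile with opposite vertices A and B says
that some vector of A and some vector of B differ by a nonzero vector common
to the two lines ([coherent_scaled], [coherent_of_vectors]).  As one of these
lines is in V, scaling moves
[f2], [f3] and any solution [f123] into the affine chart u1 + V, on which
vectors and points are in bijection ([vline_coset_inj]).  The hypotheses
become u1 - u2 in [f12], u1 - u3 in [f13], u2 - u3 in [f23], with all
differences in [f], and the problem is to find d with u1 - d in [f12] and
[f13], u2 - d in [f12] and [f23], u3 - d in [f13] and [f23].  Two solutions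
differ by a vector of all three lines, hence by 0.  For the existence
([perspective_center]) each line is the sum of its intersections with the two
others; decomposing the three vectors ui - uj accordingly and comparing
through (u1 - u2) + (u2 - u3) = u1 - u3 yields d.  The line [f] serves to show
that d is none of the ui: otherwise ui - uj would all be in one of the lines
[fij], hence on its intersection with [f], which is a single point, and the
three lines would be concurrent ([collinear_feet]).

A single polynomial cuts out the open set ([triangular_open]).  If a spans
[f1], if L, M, N are frames of [f12], [f13], [f23], and if x = c L is a vector
of [f12], then det(a, x, M) and det(a, x, N) are linear in c, and for a
outside V they vanish exactly when x is in [f13], resp. in [f23], while for a
in V they always vanish.  So the 2x2 determinant of this system in c is
nonzero exactly for triangular configurations.  Finally [exists_triangular]
shows that the open set is not empty. *)

Set Implicit Arguments.
Unset Strict Implicit.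
Unset Printing Implicit Defensive.

Import GRing.Theory.
Local Open Scope ring_scope.

(** * Coherence in terms of vectors *)

Section Flats.

Variable F : fieldType.
Implicit Types (u v w : 'rV[F]_4) (U V : {vspace 'rV[F]_4}) (l m n : line F).

Lemma flat_inj (k : nat) : injective (@flat_space F k).
Proof.
case=> U dimU [V dimV] /= eqUV; rewrite eqUV in dimU *.
by rewrite (eq_irrelevance dimU dimV).
Qed.

Lemma dim_flat (k : nat) (U : flat F k) : \dim U = k.+1.
Proof. exact/eqP/flat_dim. Qed.

Lemma flat_of_vspace (k : nat) U :
  \dim U = k.+1 -> exists P : flat F k, (P : {vspace _}) = U.
Proof. by move/eqP=> dimU; exists (Flat dimU). Qed.

Lemma point_of_vector v :
  v != 0 -> exists P : point F, (P : {vspace _}) = <[v]>%VS.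
Proof. by move=> nz_v; apply: flat_of_vspace; rewrite dim_vline nz_v. Qed.

Lemma vector_of_point (P : point F) :
  exists2 v, v != 0 & (P : {vspace _}) = <[v]>%VS.
Proof.
exists (vpick P); first by rewrite vpick0 -dimv_eq0 dim_flat.
apply/esym/eqP; rewrite -(dimv_leqif_eq _) ?dim_flat ?dim_vline.
  by rewrite vpick0 -dimv_eq0 dim_flat.
by rewrite -memvE memv_pick.
Qed.

Lemma vlineZ (k : F) v : k != 0 -> <[k *: v]>%VS = <[v]>%VS.
Proof.
move=> nz_k; apply/eqP; rewrite eqEsubv -!memvE memvZ ?memv_line //=.
by apply/vlineP; exists k^-1; rewrite scalerK.
Qed.

(** The coset u + V is an affine chart: a line through 0 outside V meets it in
at most one vector. *)
Lemma vline_coset_inj V u v :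
  u \notin V -> u - v \in V -> <[u]>%VS = <[v]>%VS -> u = v.
Proof.
move=> nVu Vuv eq_uv; have: v \in <[u]>%VS by rewrite eq_uv memv_line.
case/vlineP=> k defv; move: Vuv; rewrite defv -{1}[u]scale1r -scalerBl.
by rewrite rpredZeq (negPf nVu) orbF subr_eq0 => /eqP <-; rewrite scale1r.
Qed.

(** The common point P of l and m on the line (AB) is spanned by s u + t b, for
any vector b of B; neither coefficient vanishes since A and B avoid l, so
v = - (t / s) b works. *)
Lemma coherent_scaled (A B : point F) l m u :
    coherent A l B m -> (A : {vspace _}) = <[u]>%VS ->
  exists v, [/\ (B : {vspace _}) = <[v]>%VS, u - v \in l, u - v \in m
               & u - v != 0].
Proof.
case=> _ _ [nAl nAm nBl nBm] [P [Pl Pm PAB]] defA.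
have [p nz_p defP] := vector_of_point P.
have [b nz_b defB] := vector_of_point B.
move: nAl nAm nBl nBm Pl Pm PAB; rewrite defA defB defP -!memvE.
move=> nul num nbl nbm pl pm /memv_addP[_ /vlineP[s ->] [_ /vlineP[t ->] defp]].
have nz_s: s != 0.
  apply: contraNneq nbl => s0; move: pl; rewrite defp s0 scale0r add0r rpredZeq.
  by case/predU1P => // t0; rewrite defp s0 t0 !scale0r addr0 eqxx in nz_p.
have nz_t: t != 0.
  apply: contraNneq nul => t0; move: pl; rewrite defp t0 scale0r addr0 rpredZeq.
  by rewrite (negPf nz_s).
have defuv : u - - (s^-1 * t) *: b = s^-1 *: p.
  by rewrite defp scalerDr !scalerA mulVf // scale1r scaleNr opprK.
exists (- (s^-1 * t) *: b); rewrite defuv !memvZ // scaler_eq0 invr_eq0.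
rewrite (negPf nz_s) (negPf nz_p); split=> //.
by rewrite vlineZ // oppr_eq0 mulf_neq0 ?invr_eq0.
Qed.

(** A vector u outside a subspace V containing l and m guarantees at once that
neither point lies on either line and, as u and v are in one coset of V, that
the points are distinct. *)
Lemma coherent_of_vectors (A B : point F) l m V u v :
    (l <= V)%VS -> (m <= V)%VS -> l <> m ->
    (A : {vspace _}) = <[u]>%VS -> (B : {vspace _}) = <[v]>%VS ->
    u \notin V -> u != v -> u - v \in l -> u - v \in m ->
  coherent A l B m.
Proof.
move=> lV mV neq_lm defA defB nVu neq_uv uvl uvm.
have nVv: v \notin V.
  by apply: contra nVu => Vv; rewrite -(subrK v u) memvD // (subvP lV).
split=> //.
- move=> eqAB; case/eqP: neq_uv.
  by apply: (vline_coset_inj nVu) (subvP lV _ uvl) _; rewrite -defA eqAB.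
- by rewrite defA defB -!memvE; split;
    [apply: contra nVu | apply: contra nVu | apply: contra nVv
    | apply: contra nVv]; apply/subvP.
have [P defP] : exists P : point F, (P : {vspace _}) = <[u - v]>%VS.
  by apply: point_of_vector; rewrite subr_eq0.
exists P; rewrite defP defA defB -!memvE; split=> //.
by rewrite memv_add ?memv_line // memvN memv_line.
Qed.

(** * Three coplanar lines without a common point *)

Lemma dim_meet_lines l m V :
  (l <= V)%VS -> (m <= V)%VS -> (\dim V <= 3)%N -> (0 < \dim (l :&: m))%N.
Proof.
move=> lV mV dimV; have := dimv_sum_cap l m; rewrite !dim_flat.
have: (\dim (l + m) <= 3)%N.
  by apply: leq_trans dimV; rewrite dimvS // subv_add lV.
case: (\dim (l :&: m)) => // dim3 defdim.
by rewrite addn0 in defdim; rewrite defdim in dim3.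
Qed.

Lemma dim_meet_distinct l m : l <> m -> (\dim (l :&: m) <= 1)%N.
Proof.
move=> neq_lm; rewrite leqNgt; apply/negP=> dimI; case: neq_lm.
have eqI n : (l :&: m <= n)%VS -> (l :&: m = n)%VS.
  by move=> sIn; apply/eqP; rewrite -(geq_leqif (dimv_leqif_eq sIn)) dim_flat.
by apply: flat_inj; rewrite -[LHS]eqI ?capvSl // -[RHS]eqI ?capvSr.
Qed.

(** The two intersections are nonzero and independent, and l has dimension
2. *)
Lemma line_sum_meets l m n V :
    (l <= V)%VS -> (m <= V)%VS -> (n <= V)%VS -> (\dim V <= 3)%N ->
    (l :&: m :&: n = 0)%VS ->
  (l = l :&: m + l :&: n :> {vspace _})%VS.
Proof.
move=> lV mV nV dimV trI; apply/esym/eqP.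
have sub: (l :&: m + l :&: n <= l)%VS by rewrite subv_add !capvSl.
rewrite -(geq_leqif (dimv_leqif_eq sub)) dimv_disjoint_sum; last first.
  by rewrite capvA [(l :&: m :&: l)%VS]capvC capvA capvv trI.
by rewrite dim_flat; apply: (@leq_add 1 1); apply: dim_meet_lines dimV.
Qed.

Lemma triangle_neq l m n V :
    (l <= V)%VS -> (m <= V)%VS -> (n <= V)%VS -> (\dim V <= 3)%N ->
  (l :&: m :&: n = 0)%VS -> l <> m.
Proof.
move=> lV mV nV dimV trI eq_lm; have := dim_meet_lines mV nV dimV.
by rewrite -[in (m :&: n)%VS](capvv m) -{1}eq_lm trI dimv0.
Qed.

(** The intersection of two distinct lines p and q has dimension at most 1, so
that u, v, w are proportional and span a common point of l, m, n. *)
Lemma collinear_feet l m n (p q : line F) u v w :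
    p <> q -> (l :&: m :&: n = 0)%VS ->
    u \in (p :&: q)%VS -> v \in (p :&: q)%VS -> w \in (p :&: q)%VS ->
    u \in l -> v \in m -> w \in n -> u != 0 -> v != 0 -> w != 0 ->
  False.
Proof.
move=> neq_pq trI pqu pqv pqw ul vm wn nz_u nz_v nz_w.
have line_of x : x \in (p :&: q)%VS -> x != 0 -> (p :&: q = <[x]>)%VS.
  move=> pqx nz_x; apply/esym/eqP; move: pqx; rewrite memvE => pqx.
  by rewrite -(geq_leqif (dimv_leqif_eq pqx)) dim_vline nz_x dim_meet_distinct.
have uI: u \in (l :&: m :&: n)%VS.
  rewrite !memv_cap ul /=; apply/andP; split.
    by move: pqu; rewrite (line_of v) // => /vlineP[k ->]; rewrite memvZ.
  by move: pqu; rewrite (line_of w) // => /vlineP[k ->]; rewrite memvZ.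
by rewrite trI memv0 (negPf nz_u) in uI.
Qed.

Lemma line_split l m n V v :
    (l <= V)%VS -> (m <= V)%VS -> (n <= V)%VS -> (\dim V <= 3)%N ->
    (l :&: m :&: n = 0)%VS -> v \in l ->
  exists x y, [/\ x \in l, x \in m, y \in l, y \in n & v = x - y].
Proof.
move=> lV mV nV dimV trI; rewrite {1}(line_sum_meets lV mV nV dimV trI).
case/memv_addP=> x + [y + ->]; rewrite !memv_cap => /andP[lx mx] /andP[ly ny].
by exists x, (- y); split; rewrite ?memvN ?opprK.
Qed.

Lemma capv_perm231 (U V W : {vspace 'rV[F]_4}) :
  (U :&: V :&: W = V :&: W :&: U)%VS.
Proof. by rewrite -capvA capvC. Qed.

Lemma capv_perm213 (U V W : {vspace 'rV[F]_4}) :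
  (U :&: V :&: W = V :&: U :&: W)%VS.
Proof. by rewrite (capvC U). Qed.

(** The converse of Desargues' theorem in an affine chart: with the three
differences as hypotheses, d is the common point of the lines joining ui to
the corresponding vertex of the triangle with sides [l12], [l13], [l23].  Only
the components of the differences along the vertices matter: since the
vertices are independent, the identity (u1 - u2) + (u2 - u3) = u1 - u3 forces
the two components at each vertex to agree. *)
Lemma perspective_center (l12 l13 l23 : line F) V u1 u2 u3 :
    (l12 <= V)%VS -> (l13 <= V)%VS -> (l23 <= V)%VS -> (\dim V <= 3)%N ->
    (l12 :&: l13 :&: l23 = 0)%VS ->
    u1 - u2 \in l12 -> u1 - u3 \in l13 -> u2 - u3 \in l23 ->
  exists d, [/\ u1 - d \in (l12 :&: l13)%VS, u2 - d \in (l12 :&: l23)%VS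
               & u3 - d \in (l13 :&: l23)%VS].
Proof.
move=> sV12 sV13 sV23 dimV trI p12l p13l p23l.
have trI' x : x \in l12 -> x \in l13 -> x \in l23 -> x = 0.
  by move=> x12 x13 x23; apply/eqP; rewrite -memv0 -trI !memv_cap x12 x13.
have [q1 [q2 [q1_12 q1_13 q2_12 q2_23 def12]]] :=
  line_split sV12 sV13 sV23 dimV trI p12l.
have [|q1' [q3 [q1'_13 q1'_12 q3_13 q3_23 def13]]] :=
  line_split sV13 sV12 sV23 dimV _ p13l; first by rewrite capv_perm213.
have [|q2' [q3' [q2'_23 q2'_12 q3'_23 q3'_13 def23]]] :=
  line_split sV23 sV12 sV13 dimV _ p23l; first by rewrite capv_perm231.
have p12_23 : u1 - u3 = (u1 - u2) + (u2 - u3) by rewrite addrA subrK.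
have defq1' : q1' = (q1 - q2) + (q2' - q3') + q3.
  by rewrite -def12 -def23 -p12_23 def13 subrK.
have eq_q3 : q3 - q3' = 0.
  have e : q3 - q3' = (q1' - q1) + (q2 - q2').
    by rewrite defq1'; apply/rowP=> i; rewrite !mxE; ring.
  by apply: trI'; [rewrite e; apply: memvD | |]; apply: memvB.
have eq_q1 : q1' - q1 = 0.
  have e : q1' - q1 = q2' - q2 + (q3 - q3').
    by rewrite defq1'; apply/rowP=> i; rewrite !mxE; ring.
  by apply: trI'; [| | rewrite e eq_q3 addr0]; apply: memvB.
move/subr0_eq: eq_q1 => eq_q1; rewrite {}eq_q1 in def13.
have e2 : u2 - (u1 - q1) = q2.
  by rewrite opprB addrCA -opprB def12 opprB addrC subrK.
have e3 : u3 - (u1 - q1) = q3.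
  by rewrite opprB addrCA -opprB def13 opprB addrC subrK.
by exists (u1 - q1); rewrite subKr e2 e3 !memv_cap; split; apply/andP.
Qed.

(** * Existence and uniqueness for triangular configurations *)

Definition triangular (c : config F) : Prop :=
  (f12 c :&: f13 c :&: f23 c = 0)%VS /\
  ~~ (f1 c <= f12 c + f13 c + f23 c)%VS.

Lemma dim_coplanar l m n : coplanar l m n -> (\dim (l + m + n) <= 3)%N.
Proof.
case=> S [lS mS nS]; apply: (@leq_trans (\dim S)); last by rewrite dim_flat.
by rewrite dimvS // !subv_add lS mS.
Qed.

Lemma completes_unique (c : config F) :
  admissible c -> triangular c -> exists! d : point F, completes c d.
Proof.
case: c => f a1 a2 a3 l12 l13 l23 [/= cop coh12 coh13 coh23] [/= trI].
have [u1 nz_u1 def1] := vector_of_point a1; rewrite def1 -memvE.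
have := dim_coplanar cop; set V := (l12 + l13 + l23)%VS => dimV nVu1.
have sV12: (l12 <= V)%VS by rewrite /V -addvA addvSl.
have sV13: (l13 <= V)%VS by rewrite /V [(l12 + _)%VS]addvC -addvA addvSl.
have sV23: (l23 <= V)%VS by rewrite /V addvSr.
have [u2 [def2 p12l p12f nz_p12]] := coherent_scaled coh12 def1.
have [u3 [def3 p13l p13f nz_p13]] := coherent_scaled coh13 def1.
have in_coset x y : x \notin V -> x - y \in V -> y \notin V.
  by move=> nVx Vxy; apply: contra nVx => Vy; rewrite -(subrK y x) memvD.
have V12 := subvP sV12 _ p12l; have V13 := subvP sV13 _ p13l.
have nVu2 := in_coset _ _ nVu1 V12; have nVu3 := in_coset _ _ nVu1 V13.
have [u3' [def3' p23l p23f nz_p23]] := coherent_scaled coh23 def2.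
(* The third tile also provides a vector of f3, but both are in u1 + V. *)
have eq_u3 : u3 = u3'.
  apply: (vline_coset_inj nVu3); last by rewrite -def3.
  have ->: u3 - u3' = (u1 - u2) - (u1 - u3) + (u2 - u3').
    by apply/rowP=> i; rewrite !mxE; ring.
  by apply: memvD; [apply: memvB | apply: (subvP sV23)].
rewrite -{u3' def3'}eq_u3 in p23l p23f nz_p23.
have trI' x : x \in l12 -> x \in l13 -> x \in l23 -> x = 0.
  by move=> x12 x13 x23; apply/eqP; rewrite -memv0 -trI !memv_cap x12 x13.
have neq12f : l12 <> f by case: coh12.
have neq13f : l13 <> f by case: coh13.
have neq23f : l23 <> f by case: coh23.
have p12_23 : u1 - u3 = (u1 - u2) + (u2 - u3) by rewrite addrA subrK.
(* All three differences are in f, so that a line l carrying all of them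
   would force them to span the single point common to l and f. *)
have noaxis l : l <> f ->
    u1 - u2 \in l -> u1 - u3 \in l -> u2 - u3 \in l -> False.
  move=> neq_lf l12p l13p l23p.
  apply: (collinear_feet (p := l) (q := f) neq_lf trI _ _ _
    p12l p13l p23l) => //; by rewrite memv_cap; apply/andP.
have neq1213 := triangle_neq sV12 sV13 sV23 dimV trI.
have neq1223 : l12 <> l23.
  apply: (triangle_neq sV12 sV23 sV13 dimV).
  by rewrite -capvA (capvC l23) capvA.
have neq1323 : l13 <> l23.
  by apply: (triangle_neq sV13 sV23 sV12 dimV); rewrite -capv_perm231.
have [d []] := perspective_center sV12 sV13 sV23 dimV trI p12l p13l p23l.
rewrite !memv_cap => /andP[q1_12 q1_13] /andP[q2_12 q2_23] /andP[q3_13 q3_23].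
have nVd : d \notin V by apply: in_coset nVu1 _; apply: (subvP sV12).
have [|D defD] := @point_of_vector d.
  by apply: contraNneq nVd => ->; rewrite mem0v.
exists D; split.
  split=> /=.
  - apply: (coherent_of_vectors sV12 sV13 neq1213 def1 defD) => //.
    apply/eqP=> eq_d; apply: (noaxis l23) => //.
      by rewrite eq_d -opprB memvN.
    by rewrite eq_d -opprB memvN.
  - apply: (coherent_of_vectors sV12 sV23 neq1223 def2 defD) => //.
    apply/eqP=> eq_d; apply: (noaxis l13) => //.
      by rewrite eq_d.
    by rewrite eq_d -opprB memvN.
  - apply: (coherent_of_vectors sV13 sV23 neq1323 def3 defD) => //.
    by apply/eqP=> eq_d; apply: (noaxis l12) => //; rewrite eq_d.
move=> D' [/= coh1 coh2 coh3].
have [d1 [defd1 d1_12 d1_13 _]] := coherent_scaled coh1 def1.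
have [d2 [defd2 d2_12 d2_23 _]] := coherent_scaled coh2 def2.
have [d3 [defd3 d3_13 d3_23 _]] := coherent_scaled coh3 def3.
have nVd1 : d1 \notin V by apply: in_coset nVu1 _; rewrite (subvP sV12).
(* The three tiles of D' give three vectors of D' in the chart u1 + V. *)
have eq_d2 : d1 = d2.
  apply: (vline_coset_inj nVd1); last by rewrite -defd1.
  have ->: d1 - d2 = (u2 - d2) - (u1 - d1) + (u1 - u2).
    by apply/rowP=> i; rewrite !mxE; ring.
  apply: memvD; last exact: (subvP sV12).
  by apply: (subvP sV12); apply: memvB.
have eq_d3 : d1 = d3.
  apply: (vline_coset_inj nVd1); last by rewrite -defd1.
  have ->: d1 - d3 = (u3 - d3) - (u1 - d1) + (u1 - u3).
    by apply/rowP=> i; rewrite !mxE; ring.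
  apply: memvD; last exact: (subvP sV13).
  by apply: (subvP sV13); apply: memvB.
rewrite -{}eq_d2 {d2 defd2} in d2_12 d2_23.
rewrite -{}eq_d3 {d3 defd3} in d3_13 d3_23.
apply: flat_inj; rewrite defD defd1; congr <[_]>%VS; apply: subr0_eq.
have e x : d - d1 = (x - d1) - (x - d) by apply/rowP=> i; rewrite !mxE; ring.
apply: trI'; [rewrite (e u1) | rewrite (e u1) | rewrite (e u2)];
  exact: memvB.
Qed.

End Flats.

(** * The polynomial of triangular configurations *)

Section Polynomial.

Section Generic.

Variable R : comPzRingType.

(** The matrix, in the frame L, of the linear map taking a vector x of the
line L to the pair (det(a, x, M), det(a, x, N)).  If a is outside the lines M
and N, its kernel is the set of vectors of L in both planes a + M and a + N. *)
Definition line_pairing (a : 'rV[R]_4) (L M N : 'M[R]_(2, 4)) : 'M[R]_2 :=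
  \matrix_(i, j) \det (col_mx a (col_mx (row i L) (if j == 0 then M else N))).

Notation stack := 'M[R]_(2 + (1 + (1 + (1 + (2 + (2 + 2))))), 4).

(** In the order of the frames stacked by [frames], Y starts with the row of
[f1] and Z with the rows of [f12]. *)
Definition triangle_det (X : stack) : R :=
  let Y := dsubmx X in let Z := dsubmx (dsubmx (dsubmx Y)) in
  \det (line_pairing (usubmx Y)
    (usubmx Z) (usubmx (dsubmx Z)) (dsubmx (dsubmx Z))).

Lemma mul_line_pairing a (L M N : 'M[R]_(2, 4)) (c : 'rV[R]_2) :
  c *m line_pairing a L M N =
  \row_j \det (col_mx a (col_mx (c *m L) (if j == 0 then M else N))).
Proof.
apply/rowP=> j; rewrite mxE [RHS]mxE !big_ord_recl big_ord0 addr0 !mxE.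
set K := if _ then _ else _.
have eq_row' (u v : 'rV[R]_4) :
    row' (rshift 1 (lshift 2 0)) (col_mx a (col_mx u K)) =
    row' (rshift 1 (lshift 2 0)) (col_mx a (col_mx v K)).
  apply/matrixP=> k h; rewrite !mxE.
  have := neq_lift (rshift 1 (lshift 2 0)) k.
  case: split_ordP => r ->; rewrite ?mxE //; case: split_ordP => s -> //.
  by rewrite ord1 eqxx.
symmetry; apply: (determinant_multilinear (i0 := rshift 1 (lshift 2 0))).
- by rewrite !(rowKd, rowKu) !row_id mulmx_sum_row !big_ord_recl big_ord0 addr0.
- exact: eq_row'.
- exact: eq_row'.
Qed.
End Generic.

(** This is what makes the polynomial [triangle_poly], the determinant of the
matrix of indeterminates, evaluate at X to the determinant of X. *)
Lemma map_triangle_det (R S : comPzRingType) (f : {rmorphism R -> S}) X :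
  triangle_det (map_mx f X) = f (triangle_det X).
Proof.
rewrite /triangle_det -det_map_mx; congr (\det _); apply/matrixP=> i j.
rewrite !mxE -det_map_mx !map_col_mx map_row !(map_usubmx, map_dsubmx).
by case: ifP; rewrite ?(map_usubmx, map_dsubmx).
Qed.

Variable F : fieldType.

Definition triangle_poly : {mpoly F[44]} :=
  triangle_det (\matrix_(i < 11, j < 4) 'X_(mxvec_index i j)).

Lemma meval_triangle_poly (X : 'M[F]_(11, 4)) :
  triangle_poly.@[fun k => mxvec X 0 k] = triangle_det X.
Proof.
rewrite /triangle_poly -(map_triangle_det (meval (fun k => mxvec X 0 k))).
by congr triangle_det; apply/matrixP=> i j; rewrite !mxE /= mevalXU mxvecE.
Qed.

Lemma det_full (n : nat) (M : 'M[F]_n) (U : {vspace 'rV[F]_n}) :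
  \det M != 0 -> (forall i, row i M \in U) -> U = fullv.
Proof.
move=> nz_det MU; apply/eqP; rewrite eqEsubv subvf /=; apply/subvP=> v _.
have uM: M \in unitmx by rewrite unitmxE unitfE.
rewrite -[v](mulmxKV uM) mulmx_sum_row; apply: memv_suml => i _.
exact: memvZ.
Qed.

Lemma memv_frame (k : nat) (X : 'M[F]_(k.+1, 4)) (U : flat F k) v :
  frame X U -> reflect (exists b, v = b *m X) (v \in (U : {vspace _})).
Proof.
rewrite /frame => ->; apply: (iffP memv_sumP) => [[vs vsP ->]|[b ->]].
  have /fin_all_exists[b bP] i : exists k, vs i = k *: row i X.
    exact/vlineP/vsP.
  exists (\row_i b i); rewrite mulmx_sum_row; apply: eq_bigr => i _.
  by rewrite mxE bP.
exists (fun i => b 0 i *: row i X); last by rewrite mulmx_sum_row.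
by move=> i _; rewrite memvZ ?memv_line.
Qed.

Lemma frame_free (k : nat) (X : 'M[F]_(k.+1, 4)) (U : flat F k) (b : 'rV_k.+1) :
  frame X U -> b *m X = 0 -> b = 0.
Proof.
rewrite /frame => fX bX0; pose t := [tuple row i X | i < k.+1].
have /freeP freeX : free t.
  rewrite /free span_def big_map big_enum /= -fX dim_flat.
  by rewrite size_map size_enum_ord.
apply/rowP=> i; rewrite mxE; apply: (freeX (fun i => b 0 i)).
rewrite -[RHS]bX0 mulmx_sum_row; apply: eq_bigr => j _.
by rewrite -tnth_nth tnth_mktuple.
Qed.

Lemma det_point_line_eq0 (a v : 'rV[F]_4) (M : 'M[F]_(2, 4)) (m : line F)
    (U : {vspace 'rV[F]_4}) :
    frame M m -> a \in U -> v \in U -> (m <= U)%VS -> (\dim U <= 3)%N ->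
  \det (col_mx a (col_mx v M)) = 0.
Proof.
move=> fM Ua Uv mU dimU.
have rowsU (i : 'I_(1 + (1 + 2))) : row i (col_mx a (col_mx v M)) \in U.
  case: (split_ordP i) => j ->; first by rewrite rowKu ord1 row_id.
  rewrite rowKd; case: (split_ordP j) => r ->.
    by rewrite rowKu ord1 row_id.
  rewrite rowKd (subvP mU) //; apply/(memv_frame _ fM).
  by exists (delta_mx 0 r); rewrite rowE.
apply/eqP; apply: contraLR dimU => nz_det.
by rewrite -ltnNge (det_full nz_det rowsU) dimvf dim_matrix.
Qed.

(** In a linear relation between a, v and the rows of M, the coefficient of a
vanishes modulo V, and then that of v does not since the rows of M are
independent. *)
Lemma det_point_line_mem (a v : 'rV[F]_4) (M : 'M[F]_(2, 4)) (m : line F)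
    (V : {vspace 'rV[F]_4}) :
    frame M m -> a \notin V -> v \in V -> (m <= V)%VS ->
    \det (col_mx a (col_mx v M)) = 0 -> v \in m.
Proof.
move=> fM nVa Vv mV /eqP/det0P[w nz_w].
rewrite -[w]hsubmxK -[rsubmx w]hsubmxK !mul_row_col.
move: (lsubmx w) (lsubmx (rsubmx w)) (rsubmx (rsubmx w))
  (hsubmxK w) (hsubmxK (rsubmx w)) => s t b defw defw'.
rewrite [s]mx11_scalar [t]mx11_scalar !mul_scalar_mx => eq0.
have Vb: b *m M \in m by apply/(memv_frame _ fM); exists b.
have s0: s 0 0 = 0.
  apply/eqP; apply: contraNT nVa => nz_s.
  have: s 0 0 *: a \in V.
    by rewrite -memvN (addr0_eq eq0) memvD ?memvZ // (subvP mV).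
  by rewrite rpredZeq (negPf nz_s).
have nz_t: t 0 0 != 0.
  apply: contraNneq nz_w => t0; rewrite s0 t0 !scale0r !add0r in eq0.
  rewrite -defw -defw' (frame_free fM eq0) [s]mx11_scalar [t]mx11_scalar s0 t0.
  by rewrite raddf0 !row_mx0.
rewrite s0 scale0r add0r in eq0.
have: t 0 0 *: v \in m by rewrite -memvN (addr0_eq eq0).
by rewrite rpredZeq (negPf nz_t).
Qed.

(** Triangular implies nonzero determinant because a kernel vector would be a
common point of l, m, n.  Conversely a common point is a kernel vector, and if
the point A lies in the common plane then all the 4x4 determinants vanish. *)
Lemma det_line_pairing_neq0 (A : point F) (l m n : line F) a L M N :
    frame a A -> frame L l -> frame M m -> frame N n -> coplanar l m n ->
  ((l :&: m :&: n = 0)%VS /\ ~~ (A <= l + m + n)%VS) <->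
  \det (line_pairing a L M N) != 0.
Proof.
move=> fa fL fM fN /dim_coplanar; set V := (l + m + n)%VS => dimV.
have lV: (l <= V)%VS by rewrite /V -addvA addvSl.
have mV: (m <= V)%VS by rewrite /V (addvC l) -addvA addvSl.
have nV: (n <= V)%VS by rewrite /V addvSr.
have defA : (A : {vspace _}) = <[a]>%VS by rewrite fa big_ord1 row_id.
have mL c : c *m L \in l by apply/(memv_frame _ fL); exists c.
rewrite defA -memvE; split=> [[trI nVa] | nz_det].
  apply/negP=> /det0P[c nz_c]; rewrite mul_line_pairing => /rowP c0.
  have Vx : c *m L \in V by apply: (subvP lV).
  have xI : c *m L \in (l :&: m :&: n)%VS.
    rewrite !memv_cap mL /=; apply/andP; split.
      by apply: (det_point_line_mem fM nVa Vx mV); have := c0 0; rewrite !mxE.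
    by apply: (det_point_line_mem fN nVa Vx nV); have := c0 1; rewrite !mxE.
  rewrite trI memv0 in xI; case/eqP: nz_c.
  by apply: (frame_free fL); apply/eqP.
split.
  apply/eqP; rewrite -subv0; apply/subvP=> x.
  rewrite !memv_cap memv0 -andbA => /and3P[/(memv_frame _ fL)[c ->] xm xn].
  have dimA (k : line F) : (\dim (<[a]> + k) <= 3)%N.
    apply: leq_trans (dimv_add_leqif _ _) _; rewrite dim_flat dim_vline.
    by case: (a != 0).
  have memA (k : line F) y : y \in k -> y \in (<[a]> + k)%VS.
    by move=> ky; rewrite (subvP (addvSr _ _)).
  have aA (k : line F) : a \in (<[a]> + k)%VS.
    by rewrite (subvP (addvSl _ _)) ?memv_line.
  suffices ->: c = 0 by rewrite mul0mx.
  apply/eqP; apply: contraNT nz_det => nz_c; apply/det0P; exists c => //.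
  rewrite mul_line_pairing; apply/rowP=> j; rewrite !mxE; case: ifP => _.
    exact: (det_point_line_eq0 fM (aA m) (memA _ _ xm) (addvSr _ _) (dimA m)).
  exact: (det_point_line_eq0 fN (aA n) (memA _ _ xn) (addvSr _ _) (dimA n)).
apply: contra nz_det => Va.
suffices ->: line_pairing a L M N = 0 by rewrite det0.
apply/matrixP=> i j; rewrite !mxE.
have Vi: row i L \in V.
  by apply: (subvP lV); rewrite rowE.
case: ifP => _; first exact: (det_point_line_eq0 fM Va Vi mV dimV).
exact: (det_point_line_eq0 fN Va Vi nV dimV).
Qed.

Lemma triangular_open (c : config F) X : admissible c -> frames X c ->
  triangular c <-> triangle_poly.@[fun k => mxvec X 0 k] != 0.
Proof.
case=> cop _ _ _ [L [L12 [L13 [L23 [a1 [a2 [a3 [-> []]]]]]]]].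
move=> _ [fa1 _ _] [fL12 fL13 fL23].
rewrite meval_triangle_poly /triangle_det !(col_mxKd, col_mxKu).
exact: det_line_pairing_neq0.
Qed.

End Polynomial.

(** * A triangular configuration *)

Section Example.

Variable F : fieldType.

Let e (i : 'I_4) : 'rV[F]_4 := delta_mx 0 i.

(** With the coordinate vectors e0, ..., e3: the points e0, e0 - e1 and
e0 - e1 - e2 have differences e1, e1 + e2 and e2, which span the feet on the
line f = <e1, e2>.  The lines <e1, e3> and <e1 + e2, e3> meet in e3, and
<e2, e1 + e3> avoids e3.  All lines lie in the plane where the coordinate of
index 0 vanishes, and the three points have that coordinate equal to 1. *)
Lemma exists_triangular : exists c : config F, admissible c /\ triangular c.
Proof.
pose x0 : 'I_4 := inord 0; pose x1 : 'I_4 := inord 1.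
pose x2 : 'I_4 := inord 2; pose x3 : 'I_4 := inord 3.
have eE i j : e i 0 j = (i == j)%:R by rewrite mxE eqxx eq_sym.
have x_neq : ((x0 == x1) = false) * ((x0 == x2) = false) * ((x0 == x3) = false)
  * ((x1 == x0) = false) * ((x1 == x2) = false) * ((x1 == x3) = false)
  * ((x2 == x0) = false) * ((x2 == x1) = false) * ((x2 == x3) = false)
  * ((x3 == x0) = false) * ((x3 == x1) = false) * ((x3 == x2) = false).
  by do ![split]; rewrite -val_eqE /= !inordK.
have mem2 (u v w : 'rV[F]_4) : w \in (<[u]> + <[v]>)%VS ->
    exists s t, w = s *: u + t *: v.
  by case/memv_addP=> _ /vlineP[s ->] [_ /vlineP[t ->] ->]; exists s, t.
have nz_vec (u : 'rV[F]_4) i : u 0 i = 1 -> u != 0.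
  by move=> ui; apply: contra_eq_neq ui => ->; rewrite mxE eq_sym oner_eq0.
have lineP (u v : 'rV[F]_4) i j : u 0 i = 1 -> u 0 j = 0 -> v 0 j = 1 ->
    exists l : line F, (l : {vspace _}) = (<[u]> + <[v]>)%VS.
  move=> ui uj vj; apply: flat_of_vspace; rewrite dimv_disjoint_sum.
    by rewrite !dim_vline (nz_vec _ _ ui) (nz_vec _ _ vj).
  apply/eqP; rewrite -subv0; apply/subvP=> w; rewrite memv_cap memv0.
  case/andP=> /vlineP[k ->] /vlineP[h eq_kh]; rewrite eq_kh.
  have /rowP/(_ j) := eq_kh; rewrite !mxE uj vj mulr0 mulr1 => <-.
  by rewrite scale0r.
pose V := (<[e x1]> + <[e x2]> + <[e x3]>)%VS.
have V0 w : w \in V -> w 0 x0 = 0.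
  case/memv_addP=> y /mem2[s [t ->]] [_ /vlineP[k ->] ->].
  by rewrite !mxE !x_neq !mulr0 !addr0.
have Ve1 : e x1 \in V by rewrite /V -addvA (subvP (addvSl _ _)) ?memv_line.
have Ve2 : e x2 \in V.
  by rewrite /V (addvC <[e x1]>%VS) -addvA (subvP (addvSl _ _)) ?memv_line.
have Ve3 : e x3 \in V by rewrite /V (subvP (addvSr _ _)) ?memv_line.
have [S defS] : exists S : plane F, (S : {vspace _}) = V.
  apply: flat_of_vspace; rewrite dimv_disjoint_sum; last first.
    apply/eqP; rewrite -subv0; apply/subvP=> w; rewrite memv_cap memv0.
    case/andP=> /mem2[s [t ->]] /vlineP[h eq_w]; rewrite eq_w.
    have /rowP/(_ x3) := eq_w.
    by rewrite !mxE !x_neq !eqxx !mulr0 mulr1 addr0 => <-; rewrite scale0r.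
  have [|||l <-] := lineP (e x1) (e x2) x1 x2; rewrite ?eE ?x_neq ?eqxx //.
  by rewrite dim_flat dim_vline (nz_vec _ x3) ?eE ?eqxx.
have linesV (l : line F) u v : (l : {vspace _}) = (<[u]> + <[v]>)%VS ->
    u \in V -> v \in V -> (l <= V)%VS.
  by move=> -> Vu Vv; rewrite subv_add -!memvE Vu.
have [|||f deff] := lineP (e x1) (e x2) x1 x2; rewrite ?mxE ?x_neq ?eqxx //.
have [|||l12 def12] := lineP (e x1) (e x3) x1 x3; rewrite ?mxE ?x_neq ?eqxx //.
have [|||l13 def13] := lineP (e x1 + e x2) (e x3) x1 x3;
  rewrite ?mxE ?x_neq ?eqxx ?addr0 //.
have [|||l23 def23] := lineP (e x2) (e x1 + e x3) x2 x3;
  rewrite ?mxE ?x_neq ?eqxx ?add0r //.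
have [|a1 def1] := @point_of_vector F (e x0).
  by rewrite (nz_vec _ x0) ?mxE ?x_neq ?eqxx.
have [|a2 def2] := @point_of_vector F (e x0 - e x1).
  by rewrite (nz_vec _ x0) ?mxE ?x_neq ?eqxx ?subr0.
have [|a3 def3] := @point_of_vector F (e x0 - e x1 - e x2).
  by rewrite (nz_vec _ x0) ?mxE ?x_neq ?eqxx ?subr0.
have fV := linesV _ _ _ deff Ve1 Ve2.
have V12 := linesV _ _ _ def12 Ve1 Ve3.
have V13 := linesV _ _ _ def13 (memvD Ve1 Ve2) Ve3.
have V23 := linesV _ _ _ def23 Ve2 (memvD Ve1 Ve3).
have notV (u : 'rV[F]_4) : u 0 x0 = 1 -> u \notin V.
  by move=> u0; apply/negP=> /V0/eqP; rewrite u0 oner_eq0.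
have neq_f (l : line F) w : w \in l -> w 0 x3 = 1 -> l <> f.
  move=> lw w3 eq_lf; move: lw; rewrite eq_lf deff => /mem2[s [t eq_w]].
  move/eqP: w3; rewrite eq_w !mxE !x_neq !mulr0 addr0 eq_sym oner_eq0 //.
have p12 : e x0 - (e x0 - e x1) = e x1 by rewrite subKr.
have p13 : e x0 - (e x0 - e x1 - e x2) = e x1 + e x2.
  by rewrite -addrA -opprD subKr.
have p23 : e x0 - e x1 - (e x0 - e x1 - e x2) = e x2 by rewrite subKr.
have meml (u v : 'rV[F]_4) : u \in (<[u]> + <[v]>)%VS.
  by rewrite (subvP (addvSl _ _)) ?memv_line.
have memr (u v : 'rV[F]_4) : v \in (<[u]> + <[v]>)%VS.
  by rewrite (subvP (addvSr _ _)) ?memv_line.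
exists (Config f a1 a2 a3 l12 l13 l23); split; split=> /=.
- by exists S; rewrite defS.
- apply: (coherent_of_vectors V12 fV _ def1 def2).
  + by apply: (neq_f _ (e x3)); rewrite ?def12 ?mxE ?x_neq ?eqxx.
  + by apply: notV; rewrite mxE !eqxx.
  + by rewrite -subr_eq0 p12 (nz_vec _ x1) // mxE !eqxx.
  + by rewrite p12 def12.
  + by rewrite p12 deff.
- apply: (coherent_of_vectors V13 fV _ def1 def3).
  + by apply: (neq_f _ (e x3)); rewrite ?def13 ?mxE ?x_neq ?eqxx.
  + by apply: notV; rewrite mxE !eqxx.
  + by rewrite -subr_eq0 p13 (nz_vec _ x1) // !mxE !eqxx x_neq addr0.
  + by rewrite p13 def13.
  + by rewrite p13 deff memv_add ?memv_line.
- apply: (coherent_of_vectors V23 fV _ def2 def3).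
  + apply: (neq_f _ (e x1 + e x3)); rewrite ?def23 ?mxE ?x_neq ?eqxx //.
    by rewrite add0r.
  + by apply: notV; rewrite !mxE !eqxx x_neq subr0.
  + by rewrite -subr_eq0 p23 (nz_vec _ x2) // mxE !eqxx.
  + by rewrite p23 def23.
  + by rewrite p23 deff.
- apply/eqP; rewrite -subv0; apply/subvP=> w.
  rewrite !memv_cap memv0 def12 def13 def23.
  case/andP=> /andP[/mem2[s [t defw]] /mem2[s' [t' defw']]].
  case/mem2=> s2 [t2 defw2].
  have /rowP coord := etrans (esym defw) defw2.
  have /rowP coord' := etrans (esym defw) defw'.
  have := coord x1; have := coord x2; have := coord x3.
  have := coord' x1; have := coord' x2.
  rewrite defw !mxE !x_neq !eqxx !(mulr0, mulr1, addr0, add0r) => <- s0 -> _ <-.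
  by rewrite s0 !scale0r addr0.
apply: contra (notV (e x0) _); rewrite ?mxE ?eqxx // memvE -def1.
by move/subv_trans; apply; rewrite !subv_add V12 V13.
Qed.

End Example.

(** * Generic existence and uniqueness *)

Lemma desargues_generic (F : fieldType) :
  generically_in (@admissible F)
    (fun c => exists! f123 : point F, completes c f123).
Proof.
exists (fun c => admissible c /\ triangular c); split=> [||c [adm tri]].
- split=> [c []//|]; exists (fun p => p = triangle_poly F) => c X adm frX.
  have H := triangular_open adm frX; split=> [[_ tri]|[p ->] nz].
    by exists (triangle_poly F) => //; apply/H.
  by split=> //; apply/H.
- exact: exists_triangular.
exact: completes_unique.
Qed.

Theorem proposition9p5 (R : realType) :
  generically_in (@admissible R)
    (fun c => exists! f123 : point R, completes c f123) /\
  generically_in (@admissible R[i])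
    (fun c => exists! f123 : point R[i], completes c f123).
Proof. by split; apply: desargues_generic. Qed.
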